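(* Let $n,k\ge1$, let $A_0$ be an $n\times k$ real matrix of rank $k$, $a$ a $1\times k$ real row vector, $A_1=\begin{bmatrix}A_0\\ a\end{bmatrix}$, and let $Y_1,\dots,Y_{n+1}$ follow the linear model described in the context, with $Y_1,\dots,Y_{n+1}$ uncorrelated and with variances $\sigma_1^2\ge\sigma_2^2\ge\dots\ge\sigma_{n+1}^2$. Fix $i\in\{1,\dots,k\}$. If $$\sum_{j=1}^m\left(\Big(\sum_{l=1}^kA_{00}^{-1}(i,l)A_0(j,l)\Big)^2-\Big(\sum_{l=1}^kA_{11}^{-1}(i,l)A_0(j,l)\Big)^2\right)\ge0\qquad\text{for } m=1,2,\dots,n,$$ then the ordinary least squares estimator of the $i$-th component of $\beta$ has the variance reduction property, i.e. $V_{11}(i,i)\le V_{00}(i,i)$.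
   Context: Model: $\mathbf{Y}_0=(Y_1,\dots,Y_n)^T=A_0\beta+\epsilon_0$ and $\mathbf{Y}_1=(Y_1,\dots,Y_{n+1})^T=A_1\beta+\epsilon_1$, where $\beta\in\mathbb{R}^k$ is an unknown parameter vector, $\epsilon_0$ consists of the first $n$ components of $\epsilon_1$, $E(\epsilon_1)=0$ and $\mathrm{Cov}(\epsilon_1)=\mathbf{\Sigma}_{11}=\mathrm{Diag}\{\sigma_1^2,\dots,\sigma_{n+1}^2\}$; $\mathbf{\Sigma}_{00}=\mathrm{Diag}\{\sigma_1^2,\dots,\sigma_n^2\}$. $M(i,l)$ denotes the $(i,l)$ entry of a matrix $M$; $A_{00}=A_0^TA_0$, $A_{11}=A_1^TA_1$, and $A_{00}^{-1}(i,l)$, $A_{11}^{-1}(i,l)$ are entries of the inverse matrices. The ordinary least squares (OLS) estimators based on $n$ and $n+1$ observations are $\hat\beta_0=A_{00}^{-1}A_0^T\mathbf{Y}_0$ and $\hat\beta_1=A_{11}^{-1}A_1^T\mathbf{Y}_1$; their covariance matrices are $$V_{00}=A_{00}^{-1}A_0^T\mathbf{\Sigma}_{00}A_0A_{00}^{-1},\qquad V_{11}=A_{11}^{-1}A_1^T\mathbf{\Sigma}_{11}A_1A_{11}^{-1}.$$ *)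

(* Defs.v *)
From mathcomp Require Import all_boot all_order all_algebra.
From mathcomp Require Import all_classical all_reals all_analysis.
Set Implicit Arguments.
Unset Strict Implicit.
Unset Printing Implicit Defensive.
Import Order.TTheory GRing.Theory Num.Theory.
Local Open Scope ring_scope.

Definition coordinate (R : realType) (T : Type) (m : nat)
    (X : T -> 'cV[R]_m) (j : 'I_m) : T -> R :=
  fun w => X w j 0.

Definition square_integrable d (T : measurableType d) (R : realType)
    (P : probability T R) (m : nat) (X : T -> 'cV[R]_m) : Prop :=
  forall j, coordinate X j \in Lfun P 2%:E.

Definition has_mean d (T : measurableType d) (R : realType)
    (P : probability T R) (m : nat) (X : T -> 'cV[R]_m) (mu : 'cV[R]_m) : Prop :=
  forall j, expectation P (coordinate X j) = (mu j 0)%:E.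

Definition has_cov d (T : measurableType d) (R : realType)
    (P : probability T R) (m : nat) (X : T -> 'cV[R]_m) (S : 'M[R]_m) : Prop :=
  forall j l, covariance P (coordinate X j) (coordinate X l) = (S j l)%:E.

(* Square integrability is what gives [has_mean] and [has_cov] their usual
   meaning: the library's expectation and covariance are total functions, also
   defined on functions that are not measurable or not integrable. *)
Definition linear_model d (T : measurableType d) (R : realType)
    (P : probability T R) (m k : nat) (A : 'M[R]_(m, k)) (beta : 'cV[R]_k)
    (Sigma : 'M[R]_m) (Y eps : T -> 'cV[R]_m) : Prop :=
  [/\ forall w, Y w = A *m beta + eps w,
      square_integrable P eps,
      has_mean P eps 0
    & has_cov P eps Sigma].

Definition gram (R : realType) (m k : nat) (A : 'M[R]_(m, k)) : 'M[R]_k :=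
  A^T *m A.

Definition ols (R : realType) (T : Type) (m k : nat) (A : 'M[R]_(m, k))
    (Y : T -> 'cV[R]_m) : T -> 'cV[R]_k :=
  fun w => invmx (gram A) *m A^T *m Y w.

Definition ols_cov (R : realType) (m k : nat) (A : 'M[R]_(m, k))
    (Sigma : 'M[R]_m) : 'M[R]_k :=
  invmx (gram A) *m A^T *m Sigma *m A *m invmx (gram A).

Definition diag_sq (R : realType) (m : nat) (sigma : 'I_m -> R) : 'M[R]_m :=
  diag_mx (\row_j sigma j ^+ 2).

(* Main.v *)
Require Import Defs.
From mathcomp Require Import all_boot all_order all_algebra.
From mathcomp Require Import all_classical all_reals all_analysis.
Set Implicit Arguments.
Unset Strict Implicit.
Unset Printing Implicit Defensive.
Import Order.TTheory GRing.Theory Num.Theory.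
Local Open Scope ring_scope.

(** Both estimators are linear in the same observations: with
    [C = invmx (gram A1) *m A1^T] and
    [L = row_mx (invmx (gram A0) *m A0^T) 0], one has [ols A1 Y1 = C Y1] and
    [ols A0 Y0 = L Y1], the zero column saying that the first estimator ignores
    the last observation. Covariance being bilinear
    ([has_cov_affine]), the two covariance matrices are [C Sigma11 C^T] and
    [L Sigma11 L^T], and since [Sigma11] is diagonal the claim reads
    [0 <= \sum_j sigma_j ^+ 2 * d_j] with [d_j = L i j ^+ 2 - C i j ^+ 2].

    As the weights [sigma_j ^+ 2] are nonnegative and nonincreasing, summation
    by parts ([sumr_antitone_weight_ge0]) reduces this to the nonnegativity of
    the partial sums of [d]. Those stopping at or before [n] are the hypothesis.
    The full sum is [|row i L|^2 - |row i C|^2]; it is nonnegative because [L]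
    and [C] are both left inverses of [A1] and the least squares matrix [C] has
    the shortest rows among all left inverses ([ols_mx_min]), which is the
    Gauss-Markov inequality for errors of equal variance. *)

(** Lowering all the weights by the last one removes the last term and keeps the
    others nonnegative and nonincreasing, at the cost of a nonnegative multiple
    of the full sum; this drives the induction. *)
Lemma sumr_antitone_weight_ge0 (R : realDomainType) (p : nat)
    (w d : 'I_p -> R) :
  (forall j, 0 <= w j) ->
  (forall j l : 'I_p, (j <= l)%N -> w l <= w j) ->
  (forall m : nat, (m <= p)%N -> 0 <= \sum_(j < p | (j < m)%N) d j) ->
  0 <= \sum_j w j * d j.
Proof.
elim: p w d => [|p IH] w d w_ge0 w_decr psum; first by rewrite big_ord0.
have -> : \sum_j w j * d j =
    \sum_(j < p) (w (widen_ord (leqnSn p) j) - w ord_max)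
                 * d (widen_ord (leqnSn p) j)
    + w ord_max * \sum_j d j.
  rewrite mulr_sumr !big_ord_recr /= addrA -big_split /=; congr (_ + _).
  by apply: eq_bigr => j _; rewrite mulrBl subrK.
apply: addr_ge0; last first.
  apply: mulr_ge0 => //; have := psum p.+1 (leqnn _).
  by congr (0 <= _); apply: eq_bigl => j; rewrite ltn_ord.
apply: IH => [j|j l le_jl|m le_mp].
- by rewrite subr_ge0 w_decr //= ltnW.
- by rewrite lerB // w_decr.
- have := psum m (leqW le_mp); congr (0 <= _).
  by rewrite big_mkcond big_ord_recr /= ltnNge le_mp addr0 -big_mkcond.
Qed.

Lemma mulmx_tr_diagE (R : pzRingType) (m p : nat) (M : 'M[R]_(p, m)) (i : 'I_p) :
  (M *m M^T) i i = \sum_j M i j ^+ 2.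
Proof. by rewrite !mxE; apply: eq_bigr => j _; rewrite !mxE expr2. Qed.

Lemma mulmx_tr_eq0 (R : realDomainType) (m : nat) (u : 'rV[R]_m) :
  u *m u^T = 0 -> u = 0.
Proof.
move=> uu0; have := congr1 (fun M : 'M[R]_1 => M 0 0) uu0.
rewrite mulmx_tr_diagE mxE => /psumr_eq0P u0.
apply/rowP => j; rewrite mxE; apply/eqP; rewrite -sqrf_eq0.
by apply/eqP/u0 => // l _; exact: sqr_ge0.
Qed.

(** If [u (A^T A) = 0] then [|u A^T|^2 = u A^T A u^T = 0], so [u] is killed by
    the injective [A^T]. *)
Lemma gram_unitmx (R : realType) (m k : nat) (A : 'M[R]_(m, k)) :
  \rank A = k -> gram A \in unitmx.
Proof.
move=> rankA; rewrite -row_free_unit -kermx_eq0; apply/eqP/row_matrixP => i.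
rewrite row0; set u := row i _.
have Afree : row_free A^T by rewrite /row_free mxrank_tr rankA.
have uG : u *m (A^T *m A) = 0.
  by apply/sub_kermxP; exact: row_sub.
have /mulmx_tr_eq0 uA : (u *m A^T) *m (u *m A^T)^T = 0.
  by rewrite trmx_mul trmxK mulmxA -(mulmxA u) uG mul0mx.
by apply/eqP; rewrite -(mulmx_free_eq0 u Afree) uA.
Qed.

Definition ols_mx (R : realType) (m k : nat) (A : 'M[R]_(m, k)) : 'M[R]_(k, m) :=
  invmx (gram A) *m A^T.

Lemma ols_mxK (R : realType) (m k : nat) (A : 'M[R]_(m, k)) :
  \rank A = k -> ols_mx A *m A = 1%:M.
Proof. by move=> rankA; rewrite -mulmxA mulVmx // gram_unitmx. Qed.

Lemma tr_invmx_gram (R : realType) (m k : nat) (A : 'M[R]_(m, k)) :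
  (invmx (gram A))^T = invmx (gram A).
Proof. by rewrite trmx_inv trmx_mul trmxK. Qed.

Lemma ols_mx_tr (R : realType) (m k : nat) (A : 'M[R]_(m, k)) :
  (ols_mx A)^T = A *m invmx (gram A).
Proof. by rewrite trmx_mul trmxK tr_invmx_gram. Qed.

Lemma ols_covE (R : realType) (m k : nat) (A : 'M[R]_(m, k)) (S : 'M[R]_m) :
  ols_cov A S = ols_mx A *m S *m (ols_mx A)^T.
Proof. by rewrite ols_mx_tr !mulmxA. Qed.

(** For a left inverse [L] of [A], the difference [L - ols_mx A] kills [A], hence
    also [(ols_mx A)^T], whose columns are combinations of those of [A]: the rows
    of the difference are orthogonal to those of [ols_mx A], and Pythagoras
    applies. *)
Lemma ols_mx_min (R : realType) (m k : nat) (A : 'M[R]_(m, k))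
    (L : 'M[R]_(k, m)) (i : 'I_k) :
  \rank A = k -> L *m A = 1%:M ->
  \sum_j ols_mx A i j ^+ 2 <= \sum_j L i j ^+ 2.
Proof.
move=> rankA LA; set C := ols_mx A; pose D := L - C.
have DC : D *m C^T = 0.
  by rewrite ols_mx_tr mulmxA mulmxBl LA ols_mxK // subrr mul0mx.
have CD : C *m D^T = 0 by rewrite -[C]trmxK -trmx_mul DC trmx0.
have -> : L = C + D by rewrite addrC subrK.
rewrite -!mulmx_tr_diagE linearD /= mulmxDl !mulmxDr DC CD addr0 add0r.
rewrite [leRHS]mxE lerDl mulmx_tr_diagE.
by apply: sumr_ge0 => j _; exact: sqr_ge0.
Qed.

Section covariance_affine.
Context d (T : measurableType d) (R : realType) (P : probability T R).

Lemma Lfun2_sum (m : nat) (a : 'I_m -> R) (X : 'I_m -> T -> R) :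
  (forall j, X j \in Lfun P 2%:E) ->
  \sum_j (a j \o* X j) \in Lfun P 2%:E.
Proof.
move=> X2; rewrite rpred_sum ?lee1n // => p1 j _.
by rewrite Lfun_scale // ler1n.
Qed.

Lemma Lfun2_lincomb (m : nat) (a : 'I_m -> R) (X : 'I_m -> T -> R) (c : R) :
  (forall j, X j \in Lfun P 2%:E) ->
  (\sum_j (a j \o* X j) + cst c) \in Lfun P 2%:E.
Proof.
move=> X2; rewrite rpredD ?lee1n // => p1; last by rewrite Lfun_cst.
exact: Lfun2_sum.
Qed.

(** Square integrability makes the products [X j * Z] integrable, which is what
    additivity of the covariance rests on. *)
Lemma covariance_lincombl (m : nat) (a s : 'I_m -> R) (X : 'I_m -> T -> R)
    (c : R) (Z : T -> R) :
  (forall j, X j \in Lfun P 2%:E) -> Z \in Lfun P 2%:E ->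
  (forall j, covariance P (X j) Z = (s j)%:E) ->
  covariance P (\sum_j (a j \o* X j) + cst c) Z = (\sum_j a j * s j)%:E.
Proof.
move=> X2 Z2 XZ.
have Pfin : P setT \is a fin_num := fin_num_measure P _ measurableT.
rewrite covarianceDl ?Lfun2_sum ?Lfun_cst //.
rewrite covariance_cst_l adde0.
elim: m a s X X2 XZ => [|m IH] a s X X2 XZ.
  by rewrite !big_ord0; exact: (covariance_cst_l _ 0).
rewrite !big_ord_recr /= covarianceDl ?Lfun2_sum ?Lfun_scale ?ler1n //.
rewrite (IH _ (fun j => s (widen_ord (leqnSn m) j))) //.
by rewrite covarianceZl ?XZ ?Lfun2_mul_Lfun1 ?Lfun_subset12.
Qed.

Lemma covariance_lincombr (m : nat) (a s : 'I_m -> R) (X : 'I_m -> T -> R)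
    (c : R) (Z : T -> R) :
  (forall j, X j \in Lfun P 2%:E) -> Z \in Lfun P 2%:E ->
  (forall j, covariance P Z (X j) = (s j)%:E) ->
  covariance P Z (\sum_j (a j \o* X j) + cst c) = (\sum_j a j * s j)%:E.
Proof.
move=> X2 Z2 XZ; rewrite covarianceC; apply: covariance_lincombl => // j.
by rewrite covarianceC.
Qed.

Lemma coordinate_affine (m p : nat) (M : 'M[R]_(p, m)) (c : 'cV[R]_p)
    (X : T -> 'cV[R]_m) (j : 'I_p) :
  coordinate (fun w => M *m X w + c) j =
  \sum_l (M j l \o* coordinate X l) + cst (c j 0).
Proof.
apply/funext => w; rewrite /coordinate !mxE fctE fct_sumE; congr (_ + _).
by apply: eq_bigr => l _; rewrite mulrC.
Qed.

(** The deterministic shift is what lets the covariance of an estimator be read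
    off the errors: [M Y] differs from [M eps] by the constant [M A beta]. *)
Lemma has_cov_affine (m p : nat) (M : 'M[R]_(p, m)) (c : 'cV[R]_p)
    (X : T -> 'cV[R]_m) (S : 'M[R]_m) :
  square_integrable P X -> has_cov P X S ->
  has_cov P (fun w => M *m X w + c) (M *m S *m M^T).
Proof.
move=> X2 XS j l; rewrite !coordinate_affine.
have inner u : covariance P (coordinate X u)
    (\sum_v (M l v \o* coordinate X v) + cst (c l 0)) =
    (\sum_v M l v * S u v)%:E by exact: covariance_lincombr.
rewrite (covariance_lincombl _ _ _ _ inner) //; last exact: Lfun2_lincomb.
congr EFin; rewrite !mxE.
under eq_bigr do rewrite mulr_sumr.
rewrite exchange_big; apply: eq_bigr => v _; rewrite !mxE mulr_suml.
by apply: eq_bigr => u _; rewrite mulrCA mulrC.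
Qed.

End covariance_affine.

Theorem theorem2 (R : realType) (d : measure_display) (T : measurableType d)
  (P : probability T R) (n k : nat) (n_gt0 : (0 < n)%N) (k_gt0 : (0 < k)%N)
  (A0 : 'M[R]_(n, k)) (rankA0 : \rank A0 = k) (a : 'rV[R]_k)
  (A1 : 'M[R]_(n + 1, k)) (defA1 : A1 = col_mx A0 a)
  (beta : 'cV[R]_k) (sigma : 'I_(n + 1) -> R)
  (sigma_decr : forall j l : 'I_(n + 1),
     (j <= l)%N -> sigma l ^+ 2 <= sigma j ^+ 2)
  (Sigma00 : 'M[R]_n)
  (defSigma00 : Sigma00 = diag_sq (fun j : 'I_n => sigma (lshift 1 j)))
  (Sigma11 : 'M[R]_(n + 1)) (defSigma11 : Sigma11 = diag_sq sigma)
  (Y1 eps1 : T -> 'cV[R]_(n + 1))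
  (model1 : linear_model P A1 beta Sigma11 Y1 eps1)
  (Y0 : T -> 'cV[R]_n) (defY0 : forall w, Y0 w = usubmx (Y1 w))
  (i : 'I_k)
  (partial_sums : forall m : nat, (1 <= m <= n)%N ->
     0 <= \sum_(j < n | (j < m)%N)
            ((\sum_(l < k) invmx (gram A0) i l * A0 j l) ^+ 2
             - (\sum_(l < k) invmx (gram A1) i l * A0 j l) ^+ 2)) :
  [/\ has_cov P (ols A0 Y0) (ols_cov A0 Sigma00),
      has_cov P (ols A1 Y1) (ols_cov A1 Sigma11)
    & ols_cov A1 Sigma11 i i <= ols_cov A0 Sigma00 i i].
Proof.
have rankA1 : \rank A1 = k.
  apply/eqP; rewrite eqn_leq rank_leq_col defA1 -addsmxE -{1}rankA0.
  by rewrite mxrankS // addsmxSl.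
pose L : 'M[R]_(k, n + 1) := row_mx (ols_mx A0) 0.
have LA1 : L *m A1 = 1%:M.
  by rewrite defA1 mul_row_col mul0mx addr0 ols_mxK.
have Sigma11_block : Sigma11 = block_mx Sigma00 0 0 (drsubmx Sigma11).
  rewrite defSigma11 defSigma00 /diag_sq -[X in diag_mx X]hsubmxK diag_mx_row.
  rewrite block_mxKdr; congr (block_mx (diag_mx _) _ _ _).
  by apply/rowP => j; rewrite !mxE.
have cov0 : ols_cov A0 Sigma00 = L *m Sigma11 *m L^T.
  rewrite ols_covE Sigma11_block tr_row_mx mul_row_block mul_row_col.
  by rewrite !mul0mx trmx0 !mulmx0 !addr0.
have [Y1E eps2 _ eps_cov] := model1.
have covM M : has_cov P (fun w => M *m Y1 w) (M *m Sigma11 *m M^T).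
  have -> : (fun w => M *m Y1 w) = fun w => M *m eps1 w + M *m (A1 *m beta).
    by apply/funext => w; rewrite Y1E mulmxDr addrC.
  exact: has_cov_affine.
split.
- have -> : ols A0 Y0 = fun w => L *m Y1 w.
    apply/funext => w; rewrite /ols defY0 -[in RHS](vsubmxK (Y1 w)).
    by rewrite mul_row_col mul0mx addr0.
  by rewrite cov0; exact: covM.
- by rewrite ols_covE; exact: covM.
rewrite cov0 ols_covE.
have quadE (M : 'M[R]_(k, n + 1)) :
    (M *m Sigma11 *m M^T) i i = \sum_j sigma j ^+ 2 * M i j ^+ 2.
  rewrite defSigma11 mul_mx_diag mxE; apply: eq_bigr => j _.
  by rewrite !mxE mulrAC -expr2 mulrC.
rewrite -subr_ge0 !quadE -sumrB.
under eq_bigr do rewrite -mulrBr.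
apply: sumr_antitone_weight_ge0 => // [j|m]; first exact: sqr_ge0.
rewrite leq_eqVlt => /predU1P[->|].
  (* The full sum compares the squared lengths of the [i]-th rows. *)
  rewrite (eq_bigl xpredT) => [|j]; last by rewrite ltn_ord.
  by rewrite sumrB subr_ge0 ols_mx_min.
rewrite [X in (_ < X)%N]addn1 ltnS => le_mn.
have [->|m_gt0] := posnP m; first by rewrite big_pred0.
(* For [m <= n] the last observation does not contribute. *)
rewrite big_mkcond big_split_ord /= big_ord1 /= ltnNge addn0 le_mn addr0.
rewrite -big_mkcond /=.
have := partial_sums m; rewrite m_gt0 le_mn => /(_ isT).
congr (0 <= _); apply: eq_bigr => j _.
rewrite row_mxEl; congr (_ ^+ 2 - _ ^+ 2); rewrite !mxE; apply: eq_bigr => l _.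
  by rewrite !mxE.
by congr (_ * _); rewrite mxE defA1 col_mxEu.
Qed.
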